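(* Let $N\ge 1$ be an integer and let $L>0$ and $\Delta>0$ be real numbers. Among all step lengths $(t_1,\ldots,t_N)$ with $t_k\in\left(0,\tfrac{\sqrt{3}}{L}\right)$ for all $k\in\{1,\ldots,N\}$, the optimal step lengths for the gradient method applied to $L$-smooth functions with respect to the bound $$B(t_1,\ldots,t_N)=\left(\frac{4\Delta}{\sum_{k=1}^N \min\left(-L^2t_k^3+4t_k,\,-Lt_k^2+4t_k\right)+\tfrac{2}{L}}\right)^{\tfrac{1}{2}},$$ that is, the minimizer of $B$ over $\left(0,\tfrac{\sqrt{3}}{L}\right)^N$, are given by $$t_k=\frac{\sqrt{4/3}}{L}\qquad\text{for all } k\in\{1,\ldots,N\}.$$
   Context: A differentiable function $f:\mathbb{R}^n\to\mathbb{R}$ is $L$-smooth if $\left|f(y)-f(x)-\langle\nabla f(x),y-x\rangle\right|\le\tfrac{L}{2}\|y-x\|^2$ for all $x,y\in\mathbb{R}^n$. The gradient method with fixed step lengths is $x^{k+1}=x^k-t_k\nabla f(x^k)$, $k=1,\ldots,N$. The quantity $B(t_1,\ldots,t_N)$ is an upper bound on $\min_{1\le k\le N+1}\|\nabla f(x^k)\|$ for this method when $t_k\in(0,\sqrt{3}/L)$ for all $k$ and $f(x^1)-f^\star\le\Delta$, where $f^\star$ is the minimum value of $f$. ''Optimal with respect to the bound'' means minimizing $B$ as a function of the step lengths. *)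

(* Defs.v *)
From mathcomp Require Import all_boot all_order all_algebra.
From mathcomp Require Import reals.
Set Implicit Arguments.
Unset Strict Implicit.
Unset Printing Implicit Defensive.
Import Order.TTheory GRing.Theory Num.Theory.
Local Open Scope ring_scope.

(* Step lengths t_1, ..., t_N are indexed from 0, by 'I_N. *)
Definition admissible (R : realType) (L : R) (N : nat) (t : 'I_N -> R) : Prop :=
  forall k : 'I_N, 0 < t k < Num.sqrt 3 / L.

(* The exponent 1/2 is Num.sqrt, which is 0 at negative arguments; for
   admissible t and L, Delta > 0 the quotient is positive. *)
Definition gradient_bound (R : realType) (L Delta : R) (N : nat)
    (t : 'I_N -> R) : R :=
  Num.sqrt (4 * Delta /
    (\sum_(k < N) Num.min (- L ^+ 2 * t k ^+ 3 + 4 * t k)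
                          (- L * t k ^+ 2 + 4 * t k)
     + 2 / L)).

Definition is_minimizer (R : realType) (T : Type) (A : T -> Prop) (f : T -> R)
    (x : T) : Prop :=
  A x /\ forall y : T, A y -> f x <= f y.

(* Main.v *)
Require Import Defs.
From mathcomp Require Import all_boot all_order all_algebra.
From mathcomp Require Import reals.
From mathcomp Require Import ring lra.
Set Implicit Arguments.
Unset Strict Implicit.
Unset Printing Implicit Defensive.
Import Order.TTheory GRing.Theory Num.Theory.
Local Open Scope ring_scope.

(** The bound decreases in the sum of the terms min(- L^2 t^3 + 4 t, - L t^2 + 4 t),
    so each term can be maximized separately. With s = sqrt(4/3) / L, i.e.
    3 L^2 s^2 = 4, the cubic satisfies
      (- L^2 s^3 + 4 s) - (- L^2 t^3 + 4 t) = L^2 (t - s)^2 (t + 2 s),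
    so for t > 0 it has its unique maximum at s; since L s > 1, the minimum is
    attained by the cubic at s, hence s is also the unique maximizer of the term. *)

Definition step_gain (R : realType) (L t : R) : R :=
  Num.min (- L ^+ 2 * t ^+ 3 + 4 * t) (- L * t ^+ 2 + 4 * t).

Definition optimal_step (R : realType) (L : R) : R := Num.sqrt (4 / 3) / L.

Section StepGain.
Variables (R : realType) (L : R).
Hypothesis L_gt0 : 0 < L.
Implicit Type t : R.
Local Notation s := (optimal_step L).

Lemma optimal_step_gt0 : 0 < s.
Proof. by rewrite divr_gt0 // sqrtr_gt0; lra. Qed.

Lemma optimal_step_sqr : L ^+ 2 * s ^+ 2 = 4 / 3.
Proof.
have L_neq0 : L != 0 by rewrite gt_eqF.
rewrite -exprMn mulrC divfK // sqr_sqrtr //; lra.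
Qed.

Lemma optimal_step_ge1 : 1 <= L * s.
Proof.
have Ls_gt0 := mulr_gt0 L_gt0 optimal_step_gt0.
have := optimal_step_sqr; rewrite -exprMn => Ls2; nra.
Qed.

Lemma optimal_step_lt : s < Num.sqrt 3 / L.
Proof. by rewrite ltr_pM2r ?invr_gt0 // ltr_sqrt; lra. Qed.

Lemma step_gain_optimal : step_gain L s = - L ^+ 2 * s ^+ 3 + 4 * s.
Proof.
rewrite /step_gain; apply/min_idPl; rewrite lerD2r -subr_ge0.
have -> : - L * s ^+ 2 - - L ^+ 2 * s ^+ 3 = L * s ^+ 2 * (L * s - 1) by ring.
by rewrite mulr_ge0 ?subr_ge0 ?optimal_step_ge1 // mulr_ge0 ?sqr_ge0 // ltW.
Qed.

(** At [s] the minimum is the cubic, while at [t] it is at most the cubic; so the exact gap between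
    the cubic values is only a lower bound here. *)
Lemma step_gain_gap t :
  L ^+ 2 * (t - s) ^+ 2 * (t + 2 * s) <= step_gain L s - step_gain L t.
Proof.
have cubic_gap : - L ^+ 2 * s ^+ 3 + 4 * s - (- L ^+ 2 * t ^+ 3 + 4 * t)
    = L ^+ 2 * (t - s) ^+ 2 * (t + 2 * s).
  have := optimal_step_sqr; set a := s => Ls2.
  (* Eliminating the constant 4 turns the claim into a polynomial identity in [L], [t] and [a]. *)
  have -> : 4 = 3 * (L ^+ 2 * a ^+ 2) by lra.
  ring.
by rewrite -cubic_gap step_gain_optimal lerD2l lerN2 ge_min lexx.
Qed.

Lemma step_gain_le t : 0 < t -> step_gain L t <= step_gain L s.
Proof.
move=> t_gt0; rewrite -subr_ge0; apply: le_trans (step_gain_gap t).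
have s_gt0 := optimal_step_gt0.
by rewrite -exprMn mulr_ge0 ?sqr_ge0 //; lra.
Qed.

(** A zero gap forces [(t - s) ^+ 2 <= 0], because [L ^+ 2] and [t + 2 * s] are positive. *)
Lemma step_gain_maxP t : 0 < t -> step_gain L t = step_gain L s -> t = s.
Proof.
move=> t_gt0 gts; have := step_gain_gap t.
have s_gt0 := optimal_step_gt0.
rewrite gts subrr pmulr_lle0; last by lra.
by rewrite pmulr_rle0 ?exprn_gt0 // exprn_even_le0 // subr_eq0 => /eqP.
Qed.

(** This keeps the denominator of the bound positive. From [t * L < Num.sqrt 3] follow
    [(t * L) ^+ 2 < 4] and [t * L < 4], one for each branch of the minimum. *)
Lemma step_gain_ge0 t : 0 < t < Num.sqrt 3 / L -> 0 <= step_gain L t.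
Proof.
move=> /andP[t_gt0]; rewrite ltr_pdivlMr // => tL_lt.
have tL_gt0 : 0 < t * L by rewrite mulr_gt0.
have sqrt3_sqr : Num.sqrt 3 ^+ 2 = 3 :> R by rewrite sqr_sqrtr.
rewrite /step_gain le_min; apply/andP; split.
  have -> : - L ^+ 2 * t ^+ 3 + 4 * t = t * (4 - (t * L) ^+ 2) by ring.
  by rewrite mulr_ge0 ?ltW //; nra.
have -> : - L * t ^+ 2 + 4 * t = t * (4 - t * L) by ring.
by rewrite mulr_ge0 ?ltW //; nra.
Qed.

(** The square root preserves the order and inversion of the positive denominators reverses it,
    hence the swap of [t] and [u]. *)
Lemma gradient_bound_le (Delta : R) (N : nat) (t u : 'I_N -> R) :
    0 < Delta -> admissible L t -> admissible L u ->
  (gradient_bound L Delta t <= gradient_bound L Delta u) =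
  (\sum_(k < N) step_gain L (u k) <= \sum_(k < N) step_gain L (t k)).
Proof.
move=> Delta_gt0 adm_t adm_u.
have denom_gt0 v : admissible L v -> 0 < \sum_(k < N) step_gain L (v k) + 2 / L.
  move=> adm_v; rewrite ltr_wpDl ?divr_gt0 //.
  by apply: sumr_ge0 => k _; exact: step_gain_ge0.
have num_gt0 : 0 < 4 * Delta by lra.
rewrite /gradient_bound -!/(step_gain _ _) ler_sqrt; last first.
  by rewrite divr_ge0 ?ltW ?denom_gt0.
by rewrite ler_pM2l // lef_pV2 ?posrE ?denom_gt0 // lerD2r.
Qed.

End StepGain.

Theorem theorem3 (R : realType) (N : nat) (L Delta : R)
    (hN : (1 <= N)%N) (hL : 0 < L) (hDelta : 0 < Delta) (t : 'I_N -> R) :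
  is_minimizer (@admissible R L N) (@gradient_bound R L Delta N) t <->
  (forall k : 'I_N, t k = Num.sqrt (4 / 3) / L).
Proof.
rewrite -/(optimal_step L).
have adm_s : admissible L (fun _ : 'I_N => optimal_step L).
  by move=> k; rewrite optimal_step_gt0 // optimal_step_lt.
split=> [[adm_t min_t] k | ts].
  (* Testing minimality against the constant step shows that the gaps, each nonnegative, have a sum
     at most 0; so every gap vanishes. *)
  have := min_t _ adm_s; rewrite gradient_bound_le // => sum_le.
  have gap_ge0 (i : 'I_N) : true ->
      0 <= step_gain L (optimal_step L) - step_gain L (t i).
    by move=> _; have /andP[? _] := adm_t i; rewrite subr_ge0 step_gain_le.
  have /andP[tk_gt0 _] := adm_t k.
  apply: step_gain_maxP => //; apply/esym/eqP; rewrite -subr_eq0.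
  apply/eqP/(psumr_eq0P gap_ge0) => //.
  by apply/eqP; rewrite eq_le sumr_ge0 // andbT sumrB subr_le0.
have adm_t : admissible L t by move=> k; rewrite ts; exact: adm_s k.
split=> // u adm_u; rewrite gradient_bound_le //.
by apply: ler_sum => k _; have /andP[? _] := adm_u k; rewrite ts step_gain_le.
Qed.
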